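(* Let $\mathbb{F}$ be a field and let $q\in\mathbb{F}^*$ be not a root of unity. Let $m,n$ be arbitrary positive integers, let $d=\gcd(m,n)$, and let $f:\mathbb{Z}\to\mathbb{F}^*$ satisfy $f(i+n)=qf(i)$ for all $i\in\mathbb{Z}$. Then there is a direct sum decomposition of representations of $\mathbb{F}_q[x,y]$ $$\mathsf{V}^{m,n}_f\simeq\bigoplus_{k=0}^{d-1}\mathsf{V}^{m/d,\,n/d}_{f_k}$$ into irreducible representations, where $f_k(i)=f(k+id)$ for $0\le k<d$ and $i\in\mathbb{Z}$. Moreover, suppose $m',n'$ are positive integers and $f':\mathbb{Z}\to\mathbb{F}^*$ satisfies $f'(i+n')=qf'(i)$ for all $i\in\mathbb{Z}$. If $\mathsf{V}^{m,n}_f\simeq\mathsf{V}^{m',n'}_{f'}$ as representations of $\mathbb{F}_q[x,y]$, then $m=m'$ and $n=n'$.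
   Context: $\mathbb{F}$ is a field of arbitrary characteristic, not necessarily algebraically closed, with group of units $\mathbb{F}^*$. The quantum plane is the unital associative algebra $\mathbb{F}_q[x,y]=\mathbb{F}\{x,y\}/(yx-qxy)$ with generators $x,y$ and relation $yx=qxy$. Representations are left modules. For positive integers $m,n$ and $f:\mathbb{Z}\to\mathbb{F}^*$ with $f(i+n)=qf(i)$ for all $i\in\mathbb{Z}$, $\mathsf{V}^{m,n}_f$ denotes the representation of $\mathbb{F}_q[x,y]$ on the space $\mathbb{F}[t^{\pm1}]$ of Laurent polynomials given by $x.t^i=t^{i+n}$, $y.t^i=f(i)t^{i-m}$ for all $i\in\mathbb{Z}$. *)

(* Defs.v *)
From HB Require Import structures.
From mathcomp Require Import all_boot all_order all_algebra.
From mathcomp Require Import finmap boolp.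
From mathcomp.multinomials Require Import xfinmap monalg.

Set Implicit Arguments.
Unset Strict Implicit.
Unset Printing Implicit Defensive.

Import GRing.Theory Num.Theory.
Local Open Scope ring_scope.
Local Open Scope quotient_scope.

Definition module_iso (A : nzRingType) (M N : lmodType A) : Prop :=
  exists g : {linear M -> N}, bijective g.

Definition irreducible_module (A : nzRingType) (M : lmodType A) : Prop :=
  (exists v : M, v != 0) /\
  (forall S : {pred M}, submod_closed S -> S =i pred1 0 \/ S =i predT).

Section DirectSum.
Variables (A : nzRingType) (I : finType) (M : I -> lmodType A).

(* finitely many summands, hence all families of components *)
Definition dirsum : Type := {dffun forall i : I, M i}.
HB.instance Definition _ := Choice.on dirsum.

Implicit Types (u v w : dirsum) (a b : A).

Definition dirsum_zero : dirsum := [ffun i => 0 : M i].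
Definition dirsum_opp u : dirsum := [ffun i => - u i].
Definition dirsum_add u v : dirsum := [ffun i => u i + v i].
Definition dirsum_scale a u : dirsum := [ffun i => a *: u i].

Fact dirsum_addA : associative dirsum_add.
Proof. by move=> u v w; apply/ffunP=> i; rewrite !ffunE addrA. Qed.
Fact dirsum_addC : commutative dirsum_add.
Proof. by move=> u v; apply/ffunP=> i; rewrite !ffunE addrC. Qed.
Fact dirsum_add0 : left_id dirsum_zero dirsum_add.
Proof. by move=> u; apply/ffunP=> i; rewrite !ffunE add0r. Qed.
Fact dirsum_addN : left_inverse dirsum_zero dirsum_opp dirsum_add.
Proof. by move=> u; apply/ffunP=> i; rewrite !ffunE addNr. Qed.

HB.instance Definition _ := GRing.isZmodule.Build dirsum
  dirsum_addA dirsum_addC dirsum_add0 dirsum_addN.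

Fact dirsum_scaleA a b u :
  dirsum_scale a (dirsum_scale b u) = dirsum_scale (a * b) u.
Proof. by apply/ffunP=> i; rewrite !ffunE scalerA. Qed.
Fact dirsum_scale1 : left_id 1 dirsum_scale.
Proof. by move=> u; apply/ffunP=> i; rewrite !ffunE scale1r. Qed.
Fact dirsum_scaleDr : right_distributive dirsum_scale +%R.
Proof. by move=> a u v; apply/ffunP=> i; rewrite !ffunE scalerDr. Qed.
Fact dirsum_scaleDl u : {morph dirsum_scale^~ u : a b / a + b}.
Proof. by move=> a b; apply/ffunP=> i; rewrite !ffunE scalerDl. Qed.

HB.instance Definition _ := GRing.Zmodule_isLmodule.Build A dirsum
  dirsum_scaleA dirsum_scale1 dirsum_scaleDr dirsum_scaleDl.
End DirectSum.

Section PrincipalIdeal.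
Variables (R : nzRingType) (r : R).

(* the two-sided ideal generated by r *)
Definition principal_ideal : {pred R} := fun p =>
  `[< exists s : seq (R * R), p = \sum_(ab <- s) ab.1 * r * ab.2 >].

Lemma principal_idealP p :
  reflect (exists s : seq (R * R), p = \sum_(ab <- s) ab.1 * r * ab.2)
          (p \in principal_ideal).
Proof. exact: asboolP. Qed.

Fact principal_ideal_zmod : zmod_closed principal_ideal.
Proof.
split=> [|p p' /principal_idealP[s ->] /principal_idealP[s' ->]].
  by apply/principal_idealP; exists [::]; rewrite big_nil.
apply/principal_idealP; exists (s ++ [seq (- ab.1, ab.2) | ab <- s']).
rewrite big_cat big_map /= -sumrN; congr (_ + _).
by apply: eq_bigr => ab _; rewrite !mulNr.
Qed.

HB.instance Definition _ :=
  GRing.isZmodClosed.Build R principal_ideal principal_ideal_zmod.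

Lemma principal_idealMl a p :
  p \in principal_ideal -> a * p \in principal_ideal.
Proof.
move=> /principal_idealP[s ->]; apply/principal_idealP.
exists [seq (a * bc.1, bc.2) | bc <- s].
by rewrite big_map mulr_sumr; apply: eq_bigr => bc _; rewrite !mulrA.
Qed.

Lemma principal_idealMr a p :
  p \in principal_ideal -> p * a \in principal_ideal.
Proof.
move=> /principal_idealP[s ->]; apply/principal_idealP.
exists [seq (bc.1, bc.2 * a) | bc <- s].
by rewrite big_map mulr_suml; apply: eq_bigr => bc _; rewrite !mulrA.
Qed.

Lemma principal_ideal_gen : r \in principal_ideal.
Proof.
by apply/principal_idealP; exists [:: (1, 1)]; rewrite big_seq1 mul1r mulr1.
Qed.
End PrincipalIdeal.

(* F{x,y} is the algebra of the free monoid on the two letters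
   false (for x) and true (for y). *)
Notation free_xy F := {malg F[{fmonom bool}]}.

Section QuantumPlane.
Variables (F : fieldType) (q : F).

Definition free_x : free_xy F := << fmu false >>.
Definition free_y : free_xy F := << fmu true >>.

Definition qplane_rel : free_xy F := free_y * free_x - q *: (free_x * free_y).

Definition qplane : Type := Quotient.quot (principal_ideal qplane_rel).

HB.instance Definition _ := GRing.Zmodule.on qplane.

Definition qplane_pi (p : free_xy F) : qplane :=
  \pi_(Quotient.quot (principal_ideal qplane_rel)) p.

Definition qplane_repr (a : qplane) : free_xy F :=
  repr (a : Quotient.quot (principal_ideal qplane_rel)).

Lemma qplane_reprK : cancel qplane_repr qplane_pi.
Proof. exact: reprK. Qed.

Lemma qplane_piP p p' :
  qplane_pi p = qplane_pi p' <-> p - p' \in principal_ideal qplane_rel.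
Proof.
rewrite Quotient.idealrBE; split=> [h|/eqP h]; last exact: h.
by apply/eqP; exact: h.
Qed.

Fact qplane_pi_is_zmod_morphism : zmod_morphism qplane_pi.
Proof. by move=> p p'; rewrite /qplane_pi raddfB. Qed.
HB.instance Definition _ := GRing.isZmodMorphism.Build (free_xy F) qplane
  qplane_pi qplane_pi_is_zmod_morphism.

Definition qplane_one : qplane := qplane_pi 1.
Definition qplane_mul (a b : qplane) : qplane :=
  qplane_pi (qplane_repr a * qplane_repr b).
Definition qplane_scale (c : F) (a : qplane) : qplane :=
  qplane_pi (c *: qplane_repr a).

Lemma qplane_piM p p' :
  qplane_mul (qplane_pi p) (qplane_pi p') = qplane_pi (p * p').
Proof.
apply/qplane_piP; set u := qplane_repr _; set v := qplane_repr _.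
have -> : u * v - p * p' = (u - p) * v + p * (v - p').
  by rewrite mulrBl mulrBr addrA subrK.
by apply: rpredD; [apply: principal_idealMr | apply: principal_idealMl];
  apply/qplane_piP; rewrite qplane_reprK.
Qed.

Lemma qplane_piZ c p : qplane_scale c (qplane_pi p) = qplane_pi (c *: p).
Proof.
apply/qplane_piP; rewrite -scalerBr -mul_malgC principal_idealMl //.
by apply/qplane_piP; rewrite qplane_reprK.
Qed.

Fact qplane_mulA : associative qplane_mul.
Proof.
move=> a b c; rewrite -[a]qplane_reprK -[b]qplane_reprK -[c]qplane_reprK.
by rewrite !qplane_piM mulrA.
Qed.
Fact qplane_mul1 : left_id qplane_one qplane_mul.
Proof. by move=> a; rewrite -[a]qplane_reprK qplane_piM mul1r. Qed.
Fact qplane_mulr1 : right_id qplane_one qplane_mul.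
Proof. by move=> a; rewrite -[a]qplane_reprK qplane_piM mulr1. Qed.
Fact qplane_mulDl : left_distributive qplane_mul +%R.
Proof.
move=> a b c; rewrite -[a]qplane_reprK -[b]qplane_reprK -[c]qplane_reprK.
by rewrite -raddfD !qplane_piM mulrDl raddfD.
Qed.
Fact qplane_mulDr : right_distributive qplane_mul +%R.
Proof.
move=> a b c; rewrite -[a]qplane_reprK -[b]qplane_reprK -[c]qplane_reprK.
by rewrite -raddfD !qplane_piM mulrDr raddfD.
Qed.
Fact qplane_one_neq0 : qplane_one != 0.
Proof.
apply/eqP; rewrite -(raddf0 qplane_pi) => /qplane_piP.
rewrite subr0 => /principal_idealP[s /(congr1 (mcoeff (mone : {fmonom bool})))].
have x0 : mcoeff mone free_x = 0 by rewrite mcoeffU fmP fmU fm1.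
rewrite rmorph1 raddf_sum big1 => [/eqP|ab _]; first by rewrite oner_eq0.
by rewrite /= !rmorphM /= raddfB /= -mul_malgC !rmorphM /= x0 !(mulr0, mul0r) subr0
           mulr0 mul0r.
Qed.

HB.instance Definition _ := GRing.Zmodule_isNzRing.Build qplane
  qplane_mulA qplane_mul1 qplane_mulr1 qplane_mulDl qplane_mulDr
  qplane_one_neq0.

Fact qplane_pi_is_monoid_morphism : monoid_morphism qplane_pi.
Proof. by split=> // p p'; rewrite -qplane_piM. Qed.
HB.instance Definition _ := GRing.isMonoidMorphism.Build (free_xy F) qplane
  qplane_pi qplane_pi_is_monoid_morphism.

Fact qplane_scaleA c d a :
  qplane_scale c (qplane_scale d a) = qplane_scale (c * d) a.
Proof. by rewrite -[a]qplane_reprK !qplane_piZ scalerA. Qed.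
Fact qplane_scale1 : left_id 1 qplane_scale.
Proof. by move=> a; rewrite -[a]qplane_reprK !qplane_piZ scale1r. Qed.
Fact qplane_scaleDr : right_distributive qplane_scale +%R.
Proof.
move=> c a b; rewrite -[a]qplane_reprK -[b]qplane_reprK -raddfD !qplane_piZ.
by rewrite scalerDr raddfD.
Qed.
Fact qplane_scaleDl a : {morph qplane_scale^~ a : c d / c + d}.
Proof.
by move=> c d; rewrite -[a]qplane_reprK !qplane_piZ scalerDl raddfD.
Qed.
HB.instance Definition _ := GRing.Zmodule_isLmodule.Build F qplane
  qplane_scaleA qplane_scale1 qplane_scaleDr qplane_scaleDl.

Lemma qplane_pi_scale c p : qplane_pi (c *: p) = c *: qplane_pi p.
Proof. by rewrite [RHS]qplane_piZ. Qed.

Fact qplane_scaleAl c (a b : qplane) : c *: (a * b) = (c *: a) * b.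
Proof.
rewrite -[a]qplane_reprK -[b]qplane_reprK.
by rewrite -rmorphM -!qplane_pi_scale -rmorphM scalerAl.
Qed.
HB.instance Definition _ := GRing.Lmodule_isLalgebra.Build F qplane
  qplane_scaleAl.

Lemma malg_scaleAr c (p p' : free_xy F) : c *: (p * p') = p * (c *: p').
Proof.
apply/malgP=> k; rewrite mcoeffZ (mcoeffMlw k (fsubset_refl _) (fsubset_refl _)).
rewrite (mcoeffMlw k (fsubset_refl _) (msuppZ_le c p')) mulr_sumr.
apply: eq_bigr => k1 _; rewrite mulr_sumr; apply: eq_bigr => k2 _.
by rewrite mcoeffZ mulrnAr mulrCA.
Qed.

Fact qplane_scaleAr c (a b : qplane) : c *: (a * b) = a * (c *: b).
Proof.
rewrite -[a]qplane_reprK -[b]qplane_reprK.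
by rewrite -rmorphM -!qplane_pi_scale -rmorphM malg_scaleAr.
Qed.
HB.instance Definition _ := GRing.Lalgebra_isAlgebra.Build F qplane
  qplane_scaleAr.

Definition qplane_x : qplane := qplane_pi free_x.
Definition qplane_y : qplane := qplane_pi free_y.

Lemma qplane_commutation : qplane_y * qplane_x = q *: (qplane_x * qplane_y).
Proof.
rewrite -!rmorphM -qplane_pi_scale; apply/qplane_piP.
exact: principal_ideal_gen.
Qed.
End QuantumPlane.

(* The linear map from the space with basis K to V extending b : K -> V. *)
Section LinearExtension.
Variables (F : fieldType) (K : choiceType) (V : lmodType F).

Definition linext (b : K -> V) (g : {malg F[K]}) : V :=
  \sum_(k <- msupp g) g@_k *: b k.

Lemma linextEw b (d : {fset K}) g :
  (msupp g `<=` d)%fset -> linext b g = \sum_(k <- d) g@_k *: b k.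
Proof.
move=> le; rewrite [LHS](big_fset_incl _ le) //= => k _ /mcoeff_outdom ->.
by rewrite scale0r.
Qed.

Fact linext_is_linear b : linear (linext b).
Proof.
move=> c g h; pose d := (msupp g `|` msupp h)%fset.
have gd : (msupp g `<=` d)%fset by exact: fsubsetUl.
have hd : (msupp h `<=` d)%fset by exact: fsubsetUr.
have cgd : (msupp (c *: g + h) `<=` d)%fset.
  apply: fsubset_trans (msuppD_le _ _) _; rewrite fsubUset hd andbT.
  exact: fsubset_trans (msuppZ_le _ _) gd.
rewrite !(linextEw _ cgd, linextEw _ gd, linextEw _ hd) scaler_sumr -big_split.
by apply: eq_bigr => k _; rewrite /= mcoeffD mcoeffZ scalerDl scalerA.
Qed.
HB.instance Definition _ b :=
  GRing.isLinear.Build F {malg F[K]} V *:%R (linext b) (linext_is_linear b).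

Lemma linextU b c k : linext b << c *g k >> = c *: b k.
Proof. by rewrite (linextEw _ msuppU_le) big_seq_fset1 mcoeffUU. Qed.
End LinearExtension.

Lemma malgUZ (F : fieldType) (K : choiceType) (c : F) (k : K) :
  << c *g k >> = c *: << k >> :> {malg F[K]}.
Proof. by apply/malgP=> l; rewrite !mcoeffsE mulrnAr mulr1. Qed.

Lemma linext_eq (F : fieldType) (K : choiceType) (V : lmodType F)
    (g h : {linear {malg F[K]} -> V}) :
  (forall k, g << k >> = h << k >>) -> g =1 h.
Proof.
have gZ (u : {linear {malg F[K]} -> V}) c k : u << c *g k >> = c *: u << k >>.
  by rewrite malgUZ; exact: linearZ.
by move=> gh p; rewrite [p]monalgE !raddf_sum; apply: eq_bigr => k _;
  rewrite [LHS]gZ [RHS]gZ gh.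
Qed.

(* A vector space with two operators X, Y satisfying Y X = q X Y is a left
   qplane q-module: a word in x, y acts by composing the operators. *)
Section OperatorModule.
Variables (F : fieldType) (q : F) (V : lmodType F) (X Y : {linear V -> V}).
Hypothesis XY : forall v, Y (X v) = q *: X (Y v).

Definition word_act (w : seq bool) (v : V) : V :=
  foldr (fun b u => if b then Y u else X u) v w.

Definition free_act (p : free_xy F) (v : V) : V :=
  linext (fun w : {fmonom bool} => word_act w v) p.

Definition op_act (a : qplane q) (v : V) : V := free_act (qplane_repr a) v.

Lemma word_act_linear w c u v :
  word_act w (c *: u + v) = c *: word_act w u + word_act w v.
Proof. by elim: w => //= b w ->; case: b; rewrite linearP. Qed.

Lemma free_act_linear p c u v :
  free_act p (c *: u + v) = c *: free_act p u + free_act p v.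
Proof.
rewrite /free_act /linext scaler_sumr -big_split; apply: eq_bigr => w _ /=.
by rewrite word_act_linear scalerDr !scalerA mulrC.
Qed.

Lemma free_act0r p : free_act p 0 = 0.
Proof.
by have := free_act_linear p (-1) 0 0; rewrite !scaleN1r !addNr.
Qed.

Lemma free_actDr p u v : free_act p (u + v) = free_act p u + free_act p v.
Proof. by have := free_act_linear p 1 u v; rewrite !scale1r. Qed.

Lemma free_actZr p c v : free_act p (c *: v) = c *: free_act p v.
Proof. by have := free_act_linear p c v 0; rewrite free_act0r !addr0. Qed.

Lemma free_act_sum p (T : Type) (s : seq T) (G : T -> V) :
  free_act p (\sum_(i <- s) G i) = \sum_(i <- s) free_act p (G i).
Proof. exact: (big_morph _ (free_actDr p) (free_act0r p)). Qed.

Lemma free_actDl p p' v : free_act (p + p') v = free_act p v + free_act p' v.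
Proof. exact: raddfD. Qed.

Lemma free_act_suml (T : Type) (s : seq T) (G : T -> free_xy F) v :
  free_act (\sum_(i <- s) G i) v = \sum_(i <- s) free_act (G i) v.
Proof. exact: raddf_sum. Qed.

Lemma free_actU c w v : free_act << c *g w >> v = c *: word_act w v.
Proof. exact: linextU. Qed.

Lemma free_actZl c p v : free_act (c *: p) v = c *: free_act p v.
Proof. exact: linearZ. Qed.

Lemma free_actM p p' v : free_act (p * p') v = free_act p (free_act p' v).
Proof.
rewrite [free_act p' v]/free_act /linext free_act_sum.
rewrite malgME exchange_big free_act_suml; apply: eq_bigr => w' _.
rewrite free_act_suml free_actZr [in RHS]/free_act [in RHS]/linext scaler_sumr.
apply: eq_bigr => w _.
by rewrite free_actU fmM /word_act foldr_cat scalerA mulrC.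
Qed.

Lemma free_act_x v : free_act (free_x F) v = X v.
Proof. by rewrite free_actU scale1r fmU. Qed.

Lemma free_act_y v : free_act (free_y F) v = Y v.
Proof. by rewrite free_actU scale1r fmU. Qed.

Lemma free_act1 v : free_act 1 v = v.
Proof. by rewrite free_actU scale1r fm1. Qed.

Lemma free_actB p p' v : free_act (p - p') v = free_act p v - free_act p' v.
Proof. exact: raddfB. Qed.

Lemma free_act_ideal p v :
  p \in principal_ideal (qplane_rel q) -> free_act p v = 0.
Proof.
have rel0 u : free_act (qplane_rel q) u = 0.
  by rewrite free_actB free_actZl !free_actM !free_act_x !free_act_y XY subrr.
move=> /principal_idealP[s ->]; rewrite free_act_suml big1 // => ab _.
by rewrite !free_actM rel0 free_act0r.
Qed.

Lemma op_act_pi p v : op_act (qplane_pi q p) v = free_act p v.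
Proof.
apply/eqP; rewrite -subr_eq0 -free_actB; apply/eqP.
by apply: free_act_ideal; apply/qplane_piP; rewrite qplane_reprK.
Qed.

Fact op_actA a b v : op_act a (op_act b v) = op_act (a * b) v.
Proof.
rewrite -[a]qplane_reprK -[b]qplane_reprK -rmorphM !op_act_pi.
by rewrite free_actM.
Qed.
Fact op_act1 : left_id 1 op_act.
Proof. by move=> v; rewrite op_act_pi free_act1. Qed.
Fact op_actDr : right_distributive op_act +%R.
Proof. by move=> a u v; rewrite /op_act free_actDr. Qed.
Fact op_actDl v : {morph op_act^~ v : a b / a + b}.
Proof.
move=> a b; rewrite -[a]qplane_reprK -[b]qplane_reprK -raddfD !op_act_pi.
by rewrite free_actDl.
Qed.
End OperatorModule.

Definition qshift (F : fieldType) (q : F) (n : nat) (f : int -> F) : Prop :=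
  forall i : int, f (i + n%:Z) = q * f i.

(* Laurent polynomials, as the space with basis the t^i = << i >>, i : int *)
Notation laurent F := {malg F[int]}.

Section LaurentOperators.
Variables (F : fieldType) (q : F) (m n : nat) (f : int -> F).

Definition laurent_X : laurent F -> laurent F :=
  linext (fun i : int => << i + n%:Z >>).
Definition laurent_Y : laurent F -> laurent F :=
  linext (fun i : int => << f i *g i - m%:Z >>).
HB.instance Definition _ := GRing.Linear.on laurent_X.
HB.instance Definition _ := GRing.Linear.on laurent_Y.

Lemma laurent_XU c i : laurent_X << c *g i >> = << c *g i + n%:Z >>.
Proof. by rewrite [RHS]malgUZ; exact: linextU. Qed.

Lemma laurent_YU c i : laurent_Y << c *g i >> = << c * f i *g i - m%:Z >>.
Proof. by rewrite [RHS]malgUZ -scalerA -malgUZ; exact: linextU. Qed.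

Lemma laurent_XY : qshift q n f ->
  forall v, laurent_Y (laurent_X v) = q *: laurent_X (laurent_Y v).
Proof.
move=> fq v.
apply: (@linext_eq F int (laurent F) (laurent_Y \o laurent_X)
                   (q \*: (laurent_X \o laurent_Y))) => i /=.
by rewrite laurent_XU !laurent_YU laurent_XU !mul1r fq [LHS]malgUZ -scalerA
           -malgUZ addrAC.
Qed.
End LaurentOperators.

(* The underlying space of V^{m,n}_f; the parameters select the action. *)
Definition Vmod (F : fieldType) (q : F) (m n : nat) (f : int -> F)
  (fq : qshift q n f) : Type := laurent F.

Section LaurentModule.
Variables (F : fieldType) (q : F) (m n : nat) (f : int -> F).
Hypothesis fq : qshift q n f.

HB.instance Definition _ := GRing.Zmodule.copy (Vmod m fq) (laurent F).
HB.instance Definition _ := GRing.Zmodule_isLmodule.Build (qplane q) (Vmod m fq)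
  (op_actA (laurent_XY m fq)) (op_act1 (laurent_XY m fq))
  (@op_actDr F q (laurent F) (laurent_X n) (laurent_Y m f))
  (op_actDl (laurent_XY m fq)).

Definition Vmod_t (i : int) : Vmod m fq := << i >> : laurent F.

Lemma Vmod_x i : qplane_x q *: Vmod_t i = Vmod_t (i + n%:Z).
Proof.
rewrite [LHS](op_act_pi (laurent_XY m fq)) free_act_x.
exact: laurent_XU.
Qed.

Lemma Vmod_scalar c (v : Vmod m fq) : c%:A *: v = c *: (v : laurent F).
Proof.
rewrite -[1]/(qplane_pi q 1) -qplane_pi_scale.
by rewrite [LHS](op_act_pi (laurent_XY m fq)) free_actZl free_act1.
Qed.

Lemma Vmod_y i : qplane_y q *: Vmod_t i = (f i)%:A *: Vmod_t (i - m%:Z).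
Proof.
rewrite [LHS](op_act_pi (laurent_XY m fq)) free_act_y Vmod_scalar -malgUZ.
by rewrite -[f i]mul1r; exact: laurent_YU.
Qed.
End LaurentModule.

(* i |-> f (k + i d), d = gcd(m, n), has the shift property for n / d *)
Lemma qshift_sub (F : fieldType) (q : F) (m n : nat) (f : int -> F) :
  qshift q n f -> forall k : nat,
  qshift q (n %/ gcdn m n) (fun i => f (k%:Z + i * (gcdn m n)%:Z)).
Proof.
move=> fq k i; rewrite mulrDl -PoszM divnK ?dvdn_gcdr // addrA.
exact: fq.
Qed.

(* Main.v *)
From HB Require Import structures.
Require Import Defs.
From mathcomp Require Import all_boot all_order all_algebra.
From mathcomp Require Import finmap boolp.
From mathcomp.multinomials Require Import monalg.

Set Implicit Arguments.
Unset Strict Implicit.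
Unset Printing Implicit Defensive.

Import Order.TTheory GRing.Theory Num.Theory.
Local Open Scope ring_scope.

(** Put d = gcd(m, n). Both x and y move exponents by multiples of d, so
    F[t, t^-1] splits according to the residue of the exponent modulo d, and
    t^(k + j d) |-> t^j identifies the part of residue k with the module of
    parameters m/d, n/d and f_k ([Vmod_decomposition]).

    Irreducibility of the summands is the coprime case ([Vmod_irreducible]).
    The element x^m y^n acts diagonally: it multiplies t^i by
      lambda(i) = f(i) f(i - m) ... f(i - (n-1) m).
    The shift relation on f gives lambda(i + n) = q^n lambda(i) and, after the
    product telescopes, lambda(i + m) = q^m lambda(i); by Bezout
    lambda(i + 1) = q lambda(i). As q is not a root of unity, the lambda(i)
    are pairwise distinct ([weight_inj]), so a nonzero submodule contains some
    monomial: applying x^m y^n - lambda(i) to an element v with t^i in its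
    support removes exactly t^i from the support. From one monomial, x and y
    reach all others, because the nonnegative combinations of n and -m exhaust
    the integers.

    To recover m and n from the isomorphism class, note that x and y permute
    the lines spanned by the t^i, with n, resp. m, orbits, all infinite; hence
    V/(x-1)V has dimension n and V/(y-1)V has dimension m. The proof works in
    the dual: linear functionals fixed by x (or y) are the functions u on the
    integers with u(i + N) = g(i) u(i) for nonvanishing g, where N = n (or m);
    such u are freely determined by their values on 0, ..., N-1. A surjection
    of modules makes fixed functionals pull back injectively, which compares
    these dimensions ([fixed_functionals_le]); an isomorphism gives both
    inequalities. *)

(** * Laurent polynomials and intertwining maps *)

Lemma laurent_ind (F : fieldType) (P : laurent F -> Prop) :
  P 0 -> (forall c i v, P v -> P (c *: << i >> + v)) -> forall v, P v.
Proof.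
move=> P0 PD v; rewrite [v]monalgE.
elim: (enum_fset (msupp v)) => [|i s IH]; first by rewrite big_nil.
by rewrite big_cons malgUZ; apply: PD.
Qed.

Section Actions.
Variables (F : fieldType) (q : F).

Section Intertwine.
Variables (V W : lmodType F) (X Y : {linear V -> V}) (X' Y' : {linear W -> W}).
Variable h : {linear V -> W}.
Hypothesis hX : forall v, h (X v) = X' (h v).
Hypothesis hY : forall v, h (Y v) = Y' (h v).

Lemma op_act_intertwine (a : qplane q) v :
  h (op_act X Y a v) = op_act X' Y' a (h v).
Proof.
rewrite /op_act /free_act /linext linear_sum; apply: eq_bigr => w _ /=.
rewrite linearZ; congr (_ *: _) => /=.
by elim: (w : seq bool) => //= b s <-; case: b; rewrite ?hX ?hY.
Qed.
End Intertwine.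

Section Vmod.
Variables (m n : nat) (f : int -> F) (fq : qshift q n f).

Lemma Vmod_xE (v : Vmod m fq) : qplane_x q *: v = laurent_X n v.
Proof. by rewrite [LHS](op_act_pi (laurent_XY m fq)) free_act_x. Qed.

Lemma Vmod_yE (v : Vmod m fq) : qplane_y q *: v = laurent_Y m f v.
Proof. by rewrite [LHS](op_act_pi (laurent_XY m fq)) free_act_y. Qed.
End Vmod.

(** Since x and y generate the algebra, being a module map need only be tested
    against them, and by linearity only on monomials. *)
Lemma Vmod_linear_scale (m n m' n' : nat) (f f' : int -> F)
    (fq : qshift q n f) (fq' : qshift q n' f')
    (h : {linear laurent F -> laurent F}) :
  (forall i, h << i + n%:Z >> = laurent_X n' (h << i >>)) ->
  (forall i, f i *: h << i - m%:Z >> = laurent_Y m' f' (h << i >>)) ->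
  forall (a : qplane q) (v : Vmod m fq),
    h (a *: v) = (a *: (h v : Vmod m' fq') : Vmod m' fq').
Proof.
move=> hX hY a v.
apply: (@op_act_intertwine _ _ _ _ _ _ h) => {}v.
  pose g := [the {linear laurent F -> laurent F} of h \o laurent_X n].
  pose g' := [the {linear laurent F -> laurent F} of laurent_X n' \o h].
  by apply: (@linext_eq F int _ g g') => i /=; rewrite laurent_XU hX.
pose g := [the {linear laurent F -> laurent F} of h \o laurent_Y m f].
pose g' := [the {linear laurent F -> laurent F} of laurent_Y m' f' \o h].
apply: (@linext_eq F int _ g g') => i /=.
by rewrite laurent_YU mul1r malgUZ -hY linearZ.
Qed.
End Actions.

(** * The diagonal element x^m y^n *)

Section Scalars.
Variables (F : fieldType) (q : F) (M : lmodType (qplane q)).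
Implicit Types (c d : F) (v : M).

Lemma qplane_scaleC (a : qplane q) c v : a *: (c%:A *: v) = c%:A *: (a *: v).
Proof. by rewrite !scalerA mulr_algr mulr_algl. Qed.

Lemma qplane_scaleMA c d v : c%:A *: (d%:A *: v) = (c * d)%:A *: v.
Proof. by rewrite [LHS]scalerA mulr_algl scalerA. Qed.
End Scalars.

(** The scalar that t^i picks up under y^n. As x brings in no scalar, this is
    the eigenvalue lambda(i) of x^m y^n at t^i. *)
Definition weight (F : fieldType) (m n : nat) (f : int -> F) (i : int) : F :=
  \prod_(j < n) f (i - (j * m)%N%:Z).

Lemma qshift_iter (F : fieldType) (q : F) (n : nat) (f : int -> F) :
  qshift q n f -> forall (k : nat) i, f (i + (k * n)%N%:Z) = q ^+ k * f i.
Proof.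
move=> fq k i; elim: k => [|k IH]; first by rewrite mul0n addr0 mul1r.
by rewrite mulSnr PoszD addrA fq IH exprS mulrA.
Qed.

Section Weight.
Variables (F : fieldType) (q : F) (m n : nat) (f : int -> F).
Hypothesis fq : qshift q n f.
Hypothesis f_neq0 : forall i, f i != 0.

Lemma weight_addn i : weight m n f (i + n%:Z) = q ^+ n * weight m n f i.
Proof.
rewrite /weight -[n in q ^+ n]card_ord -prodr_const -big_split.
by apply: eq_bigr => j _; rewrite addrAC fq.
Qed.

(** Replacing i by i + m shifts the window of the product by one step: the
    factor f(i + m) enters and f(i - (n-1) m) leaves, and these differ by
    q^m, their arguments being n m apart. *)
Lemma weight_addm i : (0 < n)%N ->
  weight m n f (i + m%:Z) = q ^+ m * weight m n f i.
Proof.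
case: n fq => // n' fq' _; rewrite /weight big_ord_recl big_ord_recr /=.
rewrite mul0n subr0 mulrCA mulrC.
have -> : f (i + m%:Z) = q ^+ m * f (i - (n' * m)%N%:Z).
  rewrite -(qshift_iter fq'); congr f.
  by rewrite mulnS [(m * n')%N]mulnC PoszD addrCA subrK addrC.
congr (_ * _); apply: eq_bigr => j _; congr f.
by rewrite /bump add1n mulSn PoszD opprD addrA addrK.
Qed.

Lemma weight_addM s k i :
  (forall j, weight m n f (j + s%:Z) = q ^+ s * weight m n f j) ->
  weight m n f (i + (k * s)%N%:Z) = q ^+ (k * s) * weight m n f i.
Proof.
move=> ws; elim: k => [|k IH]; first by rewrite mul0n addr0 mul1r.
by rewrite mulSnr PoszD addrA ws IH mulrA -exprD addnC.
Qed.

(** Bezout: some multiple of m is 1 more than a multiple of n, and lambda is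
    multiplied by q^s along both shifts s = m and s = n. *)
Lemma weightS i : (0 < m)%N -> (0 < n)%N -> coprime m n -> q != 0 ->
  weight m n f (i + 1) = q * weight m n f i.
Proof.
move=> m0 n0 /eqP cop q0.
case: (egcdnP n m0) => km kn eq_mn _; rewrite cop in eq_mn.
have := weight_addM km i (fun j => weight_addm j n0).
rewrite eq_mn PoszD [_ + 1%:Z]addrC addrA (weight_addM _ _ weight_addn).
rewrite addn1 exprSr -mulrA => /mulfI; apply.
by rewrite expf_neq0.
Qed.

(** lambda(i) = q^i lambda(0), and the powers of q are distinct. *)
Lemma weight_inj : (0 < m)%N -> (0 < n)%N -> coprime m n -> q != 0 ->
  (forall k, (0 < k)%N -> ~~ k.-unity_root q) -> injective (weight m n f).
Proof.
move=> m0 n0 cop q0 qr.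
have wk k i : weight m n f (i + k%:Z) = q ^+ k * weight m n f i.
  rewrite -[k]muln1; apply: weight_addM => j.
  by rewrite expr1 weightS.
have w_neq0 i : weight m n f i != 0 by apply/prodf_neq0 => j _.
have wlt i k : weight m n f i = weight m n f (i + k%:Z) -> k = 0%N.
  move/eqP; rewrite wk -subr_eq0 -{1}[weight _ _ _ _]mul1r -mulrBl mulf_eq0.
  rewrite (negPf (w_neq0 _)) orbF subr_eq0 eq_sym => qk.
  apply/eqP; rewrite eqn0Ngt; apply/negP => /[dup] k0 /qr.
  by rewrite unity_rootE qk.
move=> i j; wlog le_ij : i j / i <= j => [th|].
  by case/orP: (le_total i j) => [/th //|/th h /esym /h].
rewrite -[j](subrK i) addrC -[j - i]gez0_abs ?subr_ge0 //.
by move/wlt ->; rewrite addr0.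
Qed.
End Weight.

Section Powers.
Variables (F : fieldType) (q : F) (m n : nat) (f : int -> F).
Hypothesis fq : qshift q n f.

Lemma Vmod_xX k i :
  qplane_x q ^+ k *: Vmod_t m fq i = Vmod_t m fq (i + (k * n)%N%:Z).
Proof.
elim: k => [|k IH]; first by rewrite scale1r mul0n addr0.
by rewrite exprS -scalerA IH Vmod_x mulSnr PoszD addrA.
Qed.

Lemma Vmod_yX k i :
  qplane_y q ^+ k *: Vmod_t m fq i =
  (weight m k f i)%:A *: Vmod_t m fq (i - (k * m)%N%:Z).
Proof.
rewrite /weight; elim: k => [|k IH].
  by rewrite expr0 big_ord0 mul0n subr0 !scale1r.
rewrite exprS -scalerA IH qplane_scaleC Vmod_y big_ord_recr /=.
by rewrite qplane_scaleMA mulSnr PoszD opprD addrA.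
Qed.

Definition diag_elt : qplane q := qplane_x q ^+ m * qplane_y q ^+ n.

Lemma diag_eltU i :
  diag_elt *: Vmod_t m fq i = (weight m n f i)%:A *: Vmod_t m fq i.
Proof.
by rewrite -scalerA Vmod_yX qplane_scaleC Vmod_xX [(n * m)%N]mulnC subrK.
Qed.

Lemma mcoeff_diag (v : Vmod m fq) i :
  (diag_elt *: v : laurent F)@_i = weight m n f i * (v : laurent F)@_i.
Proof.
elim/laurent_ind: (v : laurent F) => [|c j {}v IH].
  by rewrite [diag_elt *: _]scaler0 mcoeff0 mulr0.
rewrite -[c *: _](Vmod_scalar c (Vmod_t m fq j)).
rewrite [diag_elt *: _]scalerDr qplane_scaleC diag_eltU !Vmod_scalar.
rewrite !mcoeffD !mcoeffZ IH mulrDr; congr (_ + _).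
rewrite mcoeffU; case: eqP => [->|_]; last by rewrite !mulr0.
by rewrite mulrCA.
Qed.

End Powers.

(** * Irreducibility in the coprime case *)

Section Irreducible.
Variables (F : fieldType) (q : F) (m n : nat) (f : int -> F).
Hypothesis fq : qshift q n f.
Hypothesis f_neq0 : forall i, f i != 0.
Hypotheses (m_gt0 : (0 < m)%N) (n_gt0 : (0 < n)%N) (mn_coprime : coprime m n).
Variable S : {pred Vmod m fq}.
Hypothesis S_submod : submod_closed S.

Let S0 : 0 \in S. Proof. by case: S_submod. Qed.
Let SD u v : u \in S -> v \in S -> u + v \in S.
Proof. by move=> Su Sv; rewrite -[u]scale1r; case: S_submod => _; apply. Qed.
Let SZ a v : v \in S -> a *: v \in S.
Proof. by move=> Sv; rewrite -[_ *: _]addr0; case: S_submod => _; apply. Qed.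
Let SZV c v : c != 0 -> c%:A *: v \in S -> v \in S.
Proof.
by move=> c0 /(SZ c^-1%:A); rewrite qplane_scaleMA mulVf // !scale1r.
Qed.

(** Up to nonzero scalars x and y send t^i to t^(i+n) and t^(i-m). Bezout in
    its two one-sided forms (a n = b m + 1 and b m = a n + 1 with natural
    a, b) then gives steps +1 and -1. *)
Lemma submod_monomial_all i :
  Vmod_t m fq i \in S -> forall j, Vmod_t m fq j \in S.
Proof.
have Sx k j : Vmod_t m fq j \in S -> Vmod_t m fq (j + (k * n)%N%:Z) \in S.
  by move=> Sj; rewrite -Vmod_xX SZ.
have Sy k j : Vmod_t m fq j \in S -> Vmod_t m fq (j - (k * m)%N%:Z) \in S.
  move=> Sj; have := SZ (qplane_y q ^+ k) Sj; rewrite Vmod_yX.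
  by apply: SZV; apply/prodf_neq0 => l _.
have Sup j : Vmod_t m fq j \in S -> Vmod_t m fq (j + 1) \in S.
  move=> Sj; case: (egcdnP m n_gt0) => kn km eq_nm _.
  have := Sy km _ (Sx kn _ Sj); rewrite eq_nm gcdnC (eqP mn_coprime).
  by rewrite PoszD addrA addrAC addrK.
have Sdown j : Vmod_t m fq j \in S -> Vmod_t m fq (j - 1) \in S.
  move=> Sj; case: (egcdnP n m_gt0) => km kn eq_mn _.
  have := Sy km _ (Sx kn _ Sj); rewrite eq_mn (eqP mn_coprime).
  by rewrite PoszD opprD addrA addrK.
move=> Si j; rewrite -[j](subrK i) addrC.
elim: (j - i) => [|k IH|k IH]; first by rewrite addr0.
  by rewrite -addn1 PoszD addrA Sup.
by rewrite -addn1 PoszD opprD addrA Sdown.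
Qed.

Lemma submod_all_monomials : (forall j, Vmod_t m fq j \in S) -> S =i predT.
Proof.
move=> St v; rewrite inE; elim/laurent_ind: (v : laurent F) => [//|c i {}v Sv].
by rewrite -[c *: _](Vmod_scalar c (Vmod_t m fq i)) (SD _ Sv) // SZ.
Qed.

Hypothesis q_neq0 : q != 0.
Hypothesis q_not_root1 : forall k, (0 < k)%N -> ~~ k.-unity_root q.

(** Induction on the size of the support: x^m y^n - lambda(i) kills the
    coefficient of t^i and rescales the others by nonzero scalars. *)
Lemma submod_has_monomial (v : Vmod m fq) :
  v \in S -> v != 0 -> exists i, Vmod_t m fq i \in S.
Proof.
have [N] := ubnP #|` msupp (v : laurent F)|.
elim: N v => // N IH v; rewrite ltnS => vN Sv v0.
have [i vi] : exists i, i \in msupp (v : laurent F).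
  apply/fset0Pn; move: v0; apply: contra_neq => vs0; apply/malgP => j.
  by rewrite mcoeff0 mcoeff_outdom // vs0.
pose w : Vmod m fq := diag_elt q m n *: v - (weight m n f i)%:A *: v.
have Sw : w \in S by rewrite /w -scalerBl SZ.
have wE j : (w : laurent F)@_j =
    (weight m n f j - weight m n f i) * (v : laurent F)@_j.
  by rewrite mcoeffB mcoeff_diag Vmod_scalar mcoeffZ mulrBl.
(* w = 0 exactly when t^i was the only monomial of v *)
have [w0|w0] := eqVneq w 0.
  exists i; apply: (@SZV ((v : laurent F)@_i)); first by rewrite mcoeff_neq0.
  rewrite Vmod_scalar.
  suff -> : (v : laurent F)@_i *: Vmod_t m fq i = v :> laurent F by [].
  apply/malgP => j; rewrite mcoeffZ mcoeffU.
  case: eqP => [->|/eqP ij]; first by rewrite mulr1.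
  rewrite mulr0; have := wE j; rewrite w0 mcoeff0 => /esym/eqP.
  rewrite mulf_eq0 subr_eq0 (inj_eq (weight_inj fq _ _ _ _ _ _)) //.
  by rewrite eq_sym (negPf ij) => /eqP.
apply: (IH w) => //; apply: leq_trans vN.
rewrite [X in (_ < X)%N](cardfsD1 i) vi.
apply/fsubset_leq_card/fsubsetP => j; rewrite !inE -!mcoeff_neq0 wE mulf_eq0.
rewrite negb_or subr_eq0 => /andP[wij ->]; rewrite andbT.
by apply: contra wij => /eqP->.
Qed.

Lemma submod_trivial : S =i pred1 0 \/ S =i predT.
Proof.
have [[v Sv v0]|nS] := EM (exists2 v, v \in S & v != 0); [right|left].
  have [i Si] := submod_has_monomial Sv v0.
  exact/submod_all_monomials/(submod_monomial_all Si).
move=> v; rewrite [RHS]inE; apply/idP/eqP => [Sv|-> //].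
by apply/eqP/negPn/negP => v0; apply: nS; exists v.
Qed.
End Irreducible.

Lemma Vmod_irreducible (F : fieldType) (q : F) (m n : nat) (f : int -> F)
    (fq : qshift q n f) :
  q != 0 -> (forall k, (0 < k)%N -> ~~ k.-unity_root q) ->
  (0 < m)%N -> (0 < n)%N -> coprime m n -> (forall i, f i != 0) ->
  irreducible_module (Vmod m fq).
Proof.
move=> q0 qr m0 n0 cop f0; split; last first.
  by move=> S Ssub; apply: submod_trivial Ssub _ _.
exists (Vmod_t m fq 0); apply/eqP => /malgP /(_ 0).
by rewrite mcoeffUU mcoeff0 => /eqP; rewrite oner_eq0.
Qed.

(** * Splitting by residues of the exponent *)

Lemma module_iso_linear (A : nzRingType) (M N : lmodType A) (g : M -> N) :
  linear g -> bijective g -> module_iso M N.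
Proof.
move=> g_lin g_bij.
pose G := GRing.isLinear.Build A M N *:%R g g_lin.
pose gl : {linear M -> N} := HB.pack g G.
by exists gl.
Qed.

Section Decomposition.
Variables (F : fieldType) (d : nat).
Hypothesis d_gt0 : (0 < d)%N.

Definition residue_part (k : nat) : laurent F -> laurent F :=
  linext (fun i => if (i %% d)%Z == k%:Z then << (i %/ d)%Z >> else 0).
HB.instance Definition _ k := GRing.Linear.on (residue_part k).

Definition residue_embed (k : nat) : laurent F -> laurent F :=
  linext (fun j => << k%:Z + j * d%:Z >>).
HB.instance Definition _ k := GRing.Linear.on (residue_embed k).

Lemma residue_partU k i :
  residue_part k << i >> = if (i %% d)%Z == k%:Z then << (i %/ d)%Z >> else 0.
Proof. by rewrite /residue_part linextU scale1r. Qed.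

Lemma residue_embedU k j : residue_embed k << j >> = << k%:Z + j * d%:Z >>.
Proof. by rewrite /residue_embed linextU scale1r. Qed.

Let d_neq0 : d%:Z != 0. Proof. by case: (d) d_gt0. Qed.

Lemma residue_partK (v : laurent F) :
  \sum_(k < d) residue_embed k (residue_part k v) = v.
Proof.
elim/laurent_ind: v => [|c i v IH].
  by apply: big1 => k _; rewrite !linear0.
have IHi : \sum_(k < d) residue_embed k (residue_part k << i >>) = << i >>.
  have i_lt : (`|(i %% d)%Z| < d)%N.
    by rewrite -ltz_nat gez0_abs ?modz_ge0 // ltz_pmod.
  rewrite (bigD1 (Ordinal i_lt)) //= big1 ?addr0.
    rewrite residue_partU gez0_abs ?modz_ge0 // eqxx residue_embedU.
    by rewrite gez0_abs ?modz_ge0 // addrC -divz_eq.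
  move=> k; rewrite residue_partU -val_eqE /= => ki.
  case: eqP => [eq_k|]; last by rewrite linear0.
  by rewrite eq_k eqxx in ki.
rewrite -[in RHS]IHi -[in RHS]IH scaler_sumr -big_split; apply: eq_bigr => k _.
by rewrite /= !linearP.
Qed.

Lemma residue_embedK (k l : 'I_d) (v : laurent F) :
  residue_part l (residue_embed k v) = if k == l then v else 0.
Proof.
elim/laurent_ind: v => [|c i v IH]; first by rewrite !linear0 if_same.
rewrite !linearP /= IH residue_embedU residue_partU [k%:Z + _]addrC.
rewrite modzMDl divzMDl //.
rewrite modz_small ?divz_small ?addr0 ?eqz_nat ?ltz_nat ?ltn_ord //.
by rewrite val_eqE; case: (k == l); rewrite // scaler0 addr0.
Qed.

Variables (q : F) (m n : nat) (f : int -> F) (fq : qshift q n f).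

(** As d divides m and n, the operators x and y preserve residues modulo d and
    move the quotient by n/d and -m/d. *)
Lemma residue_part_scale k m' n' (fk : int -> F) (fkq : qshift q n' fk) :
    m = (m' * d)%N -> n = (n' * d)%N ->
    (forall i, fk i = f (k%:Z + i * d%:Z)) ->
  forall (a : qplane q) (v : Vmod m fq),
  residue_part k (a *: v) =
    (a *: (residue_part k v : Vmod m' fkq) : Vmod m' fkq).
Proof.
move=> mE nE fkE; apply: Vmod_linear_scale => i /=; rewrite !residue_partU.
  rewrite nE PoszM [i + _]addrC modzMDl divzMDl // addrC.
  by case: eqP => _; rewrite ?linear0 // laurent_XU.
rewrite mE PoszM [i - _]addrC -mulNr modzMDl divzMDl // addrC.
case: eqP => [ik|_]; last by rewrite !linear0.
by rewrite laurent_YU mul1r fkE -ik [(i %% d)%Z + _]addrC -divz_eq [RHS]malgUZ.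
Qed.
End Decomposition.

Lemma Vmod_decomposition (F : fieldType) (q : F) (m n : nat) (f : int -> F)
    (fq : qshift q n f) : (0 < m)%N ->
  module_iso (Vmod m fq)
     (dirsum (fun k : 'I_(gcdn m n) =>
        Vmod (m %/ gcdn m n) (qshift_sub m fq k) : lmodType (qplane q))).
Proof.
move=> m_gt0; set d := gcdn m n.
have d_gt0 : (0 < d)%N by rewrite gcdn_gt0 m_gt0.
set M := fun k : 'I_d => _.
pose g (v : Vmod m fq) : dirsum M :=
  [ffun k : 'I_d => (residue_part d k v : M k)].
pose g' (w : dirsum M) : Vmod m fq := \sum_(k < d) residue_embed d k (w k).
apply: (@module_iso_linear _ _ _ g) => [a u v|].
  apply/ffunP => k; rewrite !ffunE /= raddfD; congr (_ + _).
  apply: residue_part_scale => //; first by rewrite divnK ?dvdn_gcdl.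
  by rewrite divnK ?dvdn_gcdr.
exists g' => [v|w].
  rewrite -[RHS](residue_partK d_gt0); apply: eq_bigr => k _.
  by rewrite ffunE.
apply/ffunP => k; rewrite ffunE /g' raddf_sum (bigD1 k) //=.
rewrite residue_embedK // eqxx big1 ?addr0 // => l lk.
by rewrite residue_embedK // (negPf lk).
Qed.

(** * Quasi-periodic functions on the integers *)

Lemma cocycle_exists (F : fieldType) (g : int -> F) :
  (forall i, g i != 0) ->
  exists u : int -> F, u 0 = 1 /\ forall a, u (a + 1) = g a * u a.
Proof.
move=> g_neq0; exists (fun a => match a with
  | Posz b => \prod_(j < b) g j%:Z
  | Negz b => \prod_(j < b.+1) (g (Negz j))^-1 end).
split=> [|[b|[|b]]]; first exact: big_ord0.
- by rewrite -PoszD addn1 big_ord_recr mulrC.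
- have -> : Negz 0 + 1 = 0 by [].
  by rewrite big_ord1 mulfV //; exact: big_ord0.
have -> : Negz b.+1 + 1 = Negz b.
  by rewrite !NegzE -[b.+2]addn1 PoszD opprD subrK.
by rewrite [in RHS]big_ord_recr mulrCA mulfV ?mulr1.
Qed.

Section QuasiPeriodic.
Variables (F : fieldType) (N : nat) (g : int -> F).
Hypothesis g_neq0 : forall i, g i != 0.
Hypothesis N_gt0 : (0 < N)%N.

Definition quasi_periodic (u : int -> F) := forall i, u (i + N%:Z) = g i * u i.

Let N_neq0 : N%:Z != 0. Proof. by case: (N) N_gt0. Qed.

(** The values on the window 0, ..., N-1 may be prescribed: on the class of
    k modulo N, the condition is a first-order recursion that can be run in
    both directions as g does not vanish. *)
Lemma quasi_periodic_dual_basis (k : nat) : (k < N)%N ->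
  exists2 u, quasi_periodic u &
    forall j : nat, (j < N)%N -> u j%:Z = (k == j)%:R.
Proof.
move=> kN.
have [u [u0 uS]] :=
  @cocycle_exists F (fun a => g (k%:Z + a * N%:Z)) (fun _ => g_neq0 _).
exists (fun i => if (i %% N)%Z == k%:Z then u (i %/ N)%Z else 0) => [i|j jN].
  have -> : i + N%:Z = 1 * N%:Z + i by rewrite mul1r addrC.
  rewrite modzMDl divzMDl // [1 + _]addrC.
  case: eqP => [eq_k|]; last by rewrite mulr0.
  by rewrite uS -eq_k [_ + _ * _]addrC -divz_eq.
rewrite modz_small ?divz_small ?ltz_nat // u0 eqz_nat eq_sym.
by case: eqP.
Qed.

(** Values on the window 0, ..., N-1 determine the function; going down uses
    that g does not vanish. *)
Lemma quasi_periodic_eq0 u : quasi_periodic u ->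
  (forall j : nat, (j < N)%N -> u j%:Z = 0) -> forall i, u i = 0.
Proof.
move=> uN u0 i; rewrite (divz_eq i N); set a := (i %/ N)%Z.
have : (`|(i %% N)%Z| < N)%N.
  by rewrite -ltz_nat gez0_abs ?modz_ge0 // ltz_pmod.
rewrite -[(i %% N)%Z]gez0_abs ?modz_ge0 // => /u0.
elim: a => [|b IH|b IH] /[dup] uj; first by rewrite mul0r add0r.
  by move/IH => ub; rewrite -addn1 PoszD mulrDl mul1r addrAC uN ub mulr0.
move/IH => ub; apply/eqP; set i' := (X in u X == 0).
rewrite -(mulrI_eq0 _ (mulfI (g_neq0 i'))) -uN -ub; apply/eqP; congr u.
by rewrite /i' -addn1 PoszD opprD mulrDl mulN1r addrAC subrK.
Qed.
End QuasiPeriodic.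

(** * Fixed functionals and the invariance of m and n *)

Section FixedFunctionals.
Variable F : fieldType.

Definition functional (u : int -> F) : laurent F -> F := @linext F int F^o u.

Lemma functionalE u v : functional u v = \sum_(i <- msupp v) v@_i * u i.
Proof. by []. Qed.

Lemma functionalU u i : functional u << i >> = u i.
Proof. by rewrite /functional linextU scale1r. Qed.

Lemma functional_eq (u : int -> F) (h : laurent F -> F) :
  linear (h : laurent F -> F^o) -> (forall i, h << i >> = u i) ->
  forall v, h v = functional u v.
Proof.
move=> h_lin hu; elim/laurent_ind => [|c i v IH].
  by have := h_lin (-1) 0 0; rewrite !scaleN1r !addNr /functional linear0.
by rewrite h_lin IH hu /functional linearP /= linextU scale1r.
Qed.

(** The functionals fixed by T are those that vanish on (T - 1)V, that is the
    dual of V/(T - 1)V, here described by a recursion of step N. *)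
Definition fixed_functionals (T : laurent F -> laurent F) (N : nat)
    (g : int -> F) :=
  forall u, (forall v, functional u (T v) = functional u v) <->
    quasi_periodic N g u.

Lemma fixed_functionals_X n : fixed_functionals (laurent_X n) n (fun=> 1).
Proof.
move=> u; split=> [uX i|uq v].
  by have := uX << i >>; rewrite laurent_XU !functionalU mul1r.
apply: (@functional_eq u (fun v => functional u (laurent_X n v)))
    => [c v1 v2|i].
  by rewrite /functional !linearP.
by rewrite laurent_XU functionalU uq mul1r.
Qed.

(** The recursion reads upwards the action of y, which sends t^(i+m) to
    f(i+m) t^i. *)
Lemma fixed_functionals_Y m f :
  fixed_functionals (laurent_Y m f) m (fun i => f (i + m%:Z)).
Proof.
have uY u i : functional u (laurent_Y m f << i >>) = f i * u (i - m%:Z).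
  by rewrite laurent_YU mul1r /functional linextU.
move=> u; split=> [uf i|uq v].
  by have := uf << i + m%:Z >>; rewrite uY functionalU addrK.
apply: (@functional_eq u (fun v => functional u (laurent_Y m f v)))
    => [c v1 v2|i].
  by rewrite /functional !linearP.
by rewrite uY -{1}[i](subrK m%:Z) -uq subrK.
Qed.

(** If N' < N, some nonzero combination u of the dual basis of fixed
    functionals of T has u o h vanishing on t^0, ..., t^(N'-1): there are N
    unknowns and N' equations. But u o h is fixed by T', hence zero, and then
    u = 0 by surjectivity of h. *)
Lemma fixed_functionals_le (T T' h : laurent F -> laurent F) N N' g g' :
  fixed_functionals T N g -> fixed_functionals T' N' g' ->
  (0 < N)%N -> (0 < N')%N ->
  (forall i, g i != 0) -> (forall i, g' i != 0) ->
  linear h -> (forall v, exists w, h w = v) -> (forall v, h (T' v) = T (h v)) ->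
  (N <= N')%N.
Proof.
move=> cT cT' N_gt0 N'_gt0 g0 g'0 h_lin h_surj hT.
rewrite leqNgt; apply/negP=> ltN.
have /all_sig2[phi phi_q phiE] (k : 'I_N) :
    {u | quasi_periodic N g u &
      forall j : nat, (j < N)%N -> u j%:Z = (val k == j)%:R}.
  apply: cid2; exact: (quasi_periodic_dual_basis g0 N_gt0 (ltn_ord k)).
pose B : 'M[F]_(N, N') :=
  \matrix_(k, j) functional (phi k) (h << (val j)%:Z >>).
have : ~~ row_free B.
  by rewrite /row_free neq_ltn (leq_ltn_trans (rank_leq_col B)).
rewrite -kermx_eq0 => /rowV0Pn[c /sub_kermxP cB c0].
pose u i := \sum_(k < N) c 0 k * phi k i.
have uE v : functional u v = \sum_(k < N) c 0 k * functional (phi k) v.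
  under [RHS]eq_bigr do rewrite functionalE mulr_sumr.
  rewrite functionalE exchange_big; apply: eq_bigr => i _; rewrite mulr_sumr.
  by apply: eq_bigr => k _; rewrite mulrCA.
have uT : forall v, functional u (T v) = functional u v.
  apply/cT => i; rewrite /u mulr_sumr; apply: eq_bigr => k _.
  by rewrite phi_q mulrCA.
pose w i := functional u (h << i >>).
have wE v : functional u (h v) = functional w v.
  apply: (@functional_eq w (fun v => functional u (h v))) => // a v1 v2.
  by rewrite h_lin /functional linearP.
have w0 : forall i, w i = 0.
  apply: (quasi_periodic_eq0 g'0 N'_gt0) => [|j jN].
    by apply/cT' => v; rewrite -!wE hT uT.
  rewrite /w uE; have /matrixP/(_ 0 (Ordinal jN)) := cB.
  rewrite !mxE => cB0.
  by rewrite -[RHS]cB0; apply: eq_bigr => k _; rewrite mxE.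
case/eqP: c0; apply/rowP => k; rewrite mxE.
have [v hv] := h_surj << (val k)%:Z >>.
have : functional u << (val k)%:Z >> = 0.
  by rewrite -hv wE functionalE big1 // => i _; rewrite w0 mulr0.
rewrite uE (bigD1 k) //= big1 => [|l lk]; rewrite functionalU phiE //.
  by rewrite eqxx mulr1 addr0.
by rewrite val_eqE (negPf lk) mulr0.
Qed.
End FixedFunctionals.

(** Compare fixed functionals of y for the first inequality, of x for the
    second. *)
Lemma Vmod_surj_le (F : fieldType) (q : F) (m n m' n' : nat) (f f' : int -> F)
    (fq : qshift q n f) (fq' : qshift q n' f')
    (h : {linear Vmod m' fq' -> Vmod m fq}) :
  (0 < m)%N -> (0 < n)%N -> (0 < m')%N -> (0 < n')%N ->
  (forall i, f i != 0) -> (forall i, f' i != 0) ->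
  (forall v, exists w, h w = v) -> (m <= m')%N /\ (n <= n')%N.
Proof.
move=> m0 n0 m'0 n'0 f0 f'0 h_surj.
have h_lin : linear (h : laurent F -> laurent F).
  move=> c u v; rewrite -[c *: u](@Vmod_scalar F q m' n' f' fq').
  by rewrite linearP Vmod_scalar.
split.
  apply: (fixed_functionals_le (fixed_functionals_Y m f)
            (fixed_functionals_Y m' f') _ _ _ _ h_lin) => // v.
  by rewrite -(@Vmod_yE _ q m' n' f' fq') linearZ -Vmod_yE.
have one_neq0 (i : int) : (1 : F) != 0 by exact: oner_neq0.
apply: (fixed_functionals_le (@fixed_functionals_X F n)
          (@fixed_functionals_X F n') n0 n'0 one_neq0 one_neq0 h_lin) => // v.
by rewrite -(@Vmod_xE _ q m' n' f' fq') linearZ -Vmod_xE.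
Qed.

Lemma Vmod_iso_inj (F : fieldType) (q : F) (m n m' n' : nat) (f f' : int -> F)
    (fq : qshift q n f) (fq' : qshift q n' f') :
  (0 < m)%N -> (0 < n)%N -> (0 < m')%N -> (0 < n')%N ->
  (forall i, f i != 0) -> (forall i, f' i != 0) ->
  module_iso (Vmod m fq) (Vmod m' fq') -> m = m' /\ n = n'.
Proof.
move=> m0 n0 m'0 n'0 f0 f'0 [g [g' gK g'K]].
pose G := GRing.isLinear.Build _ _ _ *:%R g' (can2_linear gK g'K).
pose gl : {linear Vmod m' fq' -> Vmod m fq} := HB.pack g' G.
have [|le_m' le_n'] := @Vmod_surj_le _ _ _ _ _ _ _ _ _ _ g m'0 n'0 m0 n0 f'0 f0.
  by move=> v; exists (g' v).
have [|le_m le_n] := @Vmod_surj_le _ _ _ _ _ _ _ _ _ _ gl m0 n0 m'0 n'0 f0 f'0.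
  by move=> v; exists (g v); rewrite /= gK.
by split; apply/eqP; rewrite eqn_leq ?le_m ?le_n ?le_m' ?le_n'.
Qed.

Theorem proposition2p6 (F : fieldType) (q : F) (q_neq0 : q != 0)
    (q_not_root1 : forall k : nat, (0 < k)%N -> ~~ k.-unity_root q)
    (m n : nat) (m_gt0 : (0 < m)%N) (n_gt0 : (0 < n)%N)
    (f : int -> F) (f_neq0 : forall i : int, f i != 0)
    (f_shift : qshift q n f) :
  (module_iso (Vmod m f_shift)
     (dirsum (fun k : 'I_(gcdn m n) =>
        Vmod (m %/ gcdn m n) (qshift_sub m f_shift k) : lmodType (qplane q)))
   /\ (forall k : 'I_(gcdn m n),
         irreducible_module (Vmod (m %/ gcdn m n) (qshift_sub m f_shift k))))
  /\ (forall (m' n' : nat) (m'_gt0 : (0 < m')%N) (n'_gt0 : (0 < n')%N)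
         (f' : int -> F) (f'_neq0 : forall i : int, f' i != 0)
         (f'_shift : qshift q n' f'),
       module_iso (Vmod m f_shift) (Vmod m' f'_shift) -> m = m' /\ n = n').
Proof.
split; last first.
  by move=> m' n' m'_gt0 n'_gt0 f' f'_neq0 f'_shift; exact: Vmod_iso_inj.
split=> [|k]; first exact: Vmod_decomposition.
have d_gt0 : (0 < gcdn m n)%N by rewrite gcdn_gt0 m_gt0.
apply: Vmod_irreducible => //.
- by rewrite divn_gt0 // dvdn_leq // dvdn_gcdl.
- by rewrite divn_gt0 // dvdn_leq // dvdn_gcdr.
rewrite /coprime -(eqn_pmul2r d_gt0) muln_gcdl !divnK ?dvdn_gcdl ?dvdn_gcdr //.
by rewrite mul1n.
Qed.
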